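(* Let $\mathbf{F}=(W,R,B)$ where $W=\mathbb{N}\cup\{w\}$ with $w\notin\mathbb{N}$; $R=\mathbb{N}^2\cup\{(w,2n)\mid n\in\mathbb{N}\}$; and $B=\{X\subseteq W\mid X\text{ is finite or }W\setminus X\text{ is finite}\}$. Then $\mathbf{F}$ is a quantifiable frame which validates (every formula of) $\mathsf{K}_\Pi\mathtt{5}\mathtt{Bc}\mathtt{At}^2$ but does not validate $\exists p(\Box p\wedge\forall q(\Box q\to\Box^2(p\to q)))$.
   Context: Language. Fix a countably infinite (enumerated) set $\mathsf{Prop}$ of propositional variables. $\mathcal{L}$ is given by $\varphi::=p\mid\neg\varphi\mid(\varphi\vee\varphi)\mid\Diamond\varphi\mid\exists p\,\varphi$; $\wedge,\to,\leftrightarrow,\Box,\forall p$ are the usual abbreviations; $\mathsf{Fv}(\varphi)$ is the set of free variables. $\Diamond^0\varphi=\varphi$, $\Diamond^{k+1}\varphi=\Diamond\Diamond^k\varphi$, $\Diamond^{\le0}\varphi=\varphi$, $\Diamond^{\le k+1}\varphi=\Diamond^{\le k}\varphi\vee\Diamond^{k+1}\varphi$; $\Box^k,\Box^{\le k}$ are defined dually. Semantics. A general frame is $\mathbf{F}=(W,R,B)$ where $W\ne\varnothing$, $R\subseteq W^2$ and $B\subseteq\wp(W)$ is non-empty and closed under Boolean operations and $m_\Diamond(X)=\{w\in W\mid\exists u\in X,\ wRu\}$. A valuation is $v:\mathsf{Prop}\to B$; $[\![p]\!]^{\mathbf F}(v)=v(p)$, $\neg,\vee$ are interpreted by complement and union,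 $[\![\Diamond\varphi]\!]^{\mathbf F}(v)=m_\Diamond([\![\varphi]\!]^{\mathbf F}(v))$, $[\![\exists p\,\varphi]\!]^{\mathbf F}(v)=\bigcup\{[\![\varphi]\!]^{\mathbf F}(v[X/p])\mid X\in B\}$, where $v[X/p]$ agrees with $v$ except for sending $p$ to $X$. $\varphi$ is valid on (validated by) $\mathbf F$ if $[\![\varphi]\!]^{\mathbf F}(v)=W$ for all valuations $v$. A quantifiable frame is a general frame with $[\![\varphi]\!]^{\mathbf F}(v)\in B$ for all $\varphi\in\mathcal{L}$ and all valuations $v$. Substitutions. A substitution is $\sigma:\mathsf{Prop}\to\mathcal{L}$; $\sigma_p^\psi$ agrees with $\sigma$ except that it sends $p$ to $\psi$. It extends to $\mathcal{L}$ by commuting with $\neg,\vee,\Diamond$ and $\sigma(\exists p\,\varphi)=\exists q\,\sigma_p^q(\varphi)$, where $q=p$ if $p\notin\bigcup_{r\in\mathsf{Fv}(\exists p\varphi)}\mathsf{Fv}(\sigma(r))$ and otherwise $q$ is the first variable not used in $\exists p\,\varphi$ nor in any $\sigma(r)$, $r\in\mathsf{Fv}(\exists p\,\varphi)$. $\iota$ is the identity substitution. Logics. A normal propositionally quantified modal logic (NPQML) is a set $\Lambda\subseteq\mathcal{L}$ such that: all propositional tautologies are in $\Lambda$; $\Box(p\to q)\to(\Box p\to\Box q)$ and $\Diamond p\leftrightarrow\neg\Box\neg p$ are in $\Lambda$; all instances of $\iota_p^\psi(\varphi)\to\exists p\,\varphi$ are in $\Lambda$; $\varphi\in\Lambda$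 implies $\Box\varphi\in\Lambda$; $\varphi,\varphi\to\psi\in\Lambda$ imply $\psi\in\Lambda$; if $\varphi\to\psi\in\Lambda$ and $p\notin\mathsf{Fv}(\psi)$ then $\exists p\,\varphi\to\psi\in\Lambda$. $\mathsf{K}_\Pi A_1\dots A_k$ is the smallest NPQML containing all (instances of) $A_1,\dots,A_k$. Axioms. $\mathtt{5}=\Diamond p\to\Box\Diamond p$. $\mathtt{Bc}$ is the Barcan scheme $\Diamond\exists p\,\varphi\to\exists p\,\Diamond\varphi$. $\mathtt{Q}^n(\varphi)=\Diamond^{\le n}\varphi\wedge\forall p(\Box^{\le n}(\varphi\to p)\vee\Box^{\le n}(\varphi\to\neg p))$ with $p$ the first variable not in $\mathsf{Fv}(\varphi)$. $\mathtt{At}^n=\forall q(\Diamond^{\le n}q\to\exists p(\mathtt{Q}^n(p)\wedge\Box^{\le n}(p\to q)))$. *)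

(* Defs.v *)
From mathcomp Require Import all_boot.
From mathcomp Require Import boolp classical_sets cardinality.

Set Implicit Arguments.
Unset Strict Implicit.
Unset Printing Implicit Defensive.

Local Open Scope classical_set_scope.

Notation pvar := nat (only parsing).

Definition update (T : Type) (f : pvar -> T) (p : pvar) (x : T) : pvar -> T :=
  fun r => if r == p then x else f r.

Inductive formula : Type :=
  | Var of pvar
  | Neg of formula
  | Or of formula & formula
  | Dia of formula
  | Ex of pvar & formula.

Definition And (phi psi : formula) := Neg (Or (Neg phi) (Neg psi)).
Definition Imp (phi psi : formula) := Or (Neg phi) psi.
Definition Iff (phi psi : formula) := And (Imp phi psi) (Imp psi phi).
Definition Box (phi : formula) := Neg (Dia (Neg phi)).
Definition All (p : pvar) (phi : formula) := Neg (Ex p (Neg phi)).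

Definition dia_iter (k : nat) (phi : formula) := iter k Dia phi.
Definition box_iter (k : nat) (phi : formula) := iter k Box phi.

Fixpoint dia_le (k : nat) (phi : formula) : formula :=
  if k is j.+1 then Or (dia_le j phi) (dia_iter j.+1 phi) else phi.

Fixpoint box_le (k : nat) (phi : formula) : formula :=
  if k is j.+1 then And (box_le j phi) (box_iter j.+1 phi) else phi.

Fixpoint Fv (phi : formula) : seq pvar :=
  match phi with
  | Var p => [:: p]
  | Neg psi => Fv psi
  | Or psi chi => Fv psi ++ Fv chi
  | Dia psi => Fv psi
  | Ex p psi => [seq r <- Fv psi | r != p]
  end.

(* All variables used in a formula: free, bound, or merely quantified. *)
Fixpoint vars (phi : formula) : seq pvar :=
  match phi with
  | Var p => [:: p]
  | Neg psi => vars psi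
  | Or psi chi => vars psi ++ vars chi
  | Dia psi => vars psi
  | Ex p psi => p :: vars psi
  end.

Lemma exists_notin (s : seq pvar) : exists p, p \notin s.
Proof.
exists (\max_(x <- s) x).+1; apply/negP => xs.
by have := @leq_bigmax_seq _ s xpredT id _ xs isT; rewrite ltnn.
Qed.

Definition first_notin (s : seq pvar) : pvar := ex_minn (exists_notin s).

Fixpoint subst (sigma : pvar -> formula) (phi : formula) : formula :=
  match phi with
  | Var p => sigma p
  | Neg psi => Neg (subst sigma psi)
  | Or psi chi => Or (subst sigma psi) (subst sigma chi)
  | Dia psi => Dia (subst sigma psi)
  | Ex p psi =>
      let fv := Fv (Ex p psi) in
      let q :=
        if p \notin flatten [seq Fv (sigma r) | r <- fv] then p
        else first_notin
               (vars (Ex p psi) ++ flatten [seq vars (sigma r) | r <- fv]) in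
      Ex q (subst (update sigma p (Var q)) psi)
  end.

Definition subst1 (p : pvar) (psi phi : formula) : formula :=
  subst (update Var p psi) phi.

Record frame : Type := Frame {
  world : Type;
  acc : world -> world -> Prop;
  adm : set (set world)
}.
Arguments adm : clear implicits.

Definition mdia (F : frame) (X : set (world F)) : set (world F) :=
  [set w | exists2 u, X u & acc w u].

Definition general_frame (F : frame) : Prop :=
  [/\ [set: world F] !=set0,
      adm F !=set0,
      (forall X, adm F X -> adm F (~` X)),
      (forall X Y, adm F X -> adm F Y -> adm F (X `|` Y))
    & (forall X, adm F X -> adm F (mdia X))].

Definition valuation (F : frame) (v : pvar -> set (world F)) : Prop :=
  forall p, adm F (v p).

Fixpoint sem (F : frame) (v : pvar -> set (world F)) (phi : formula) :
    set (world F) :=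
  match phi with
  | Var p => v p
  | Neg psi => ~` sem v psi
  | Or psi chi => sem v psi `|` sem v chi
  | Dia psi => mdia (sem v psi)
  | Ex p psi => \bigcup_(X in adm F) sem (update v p X) psi
  end.

Definition validates (F : frame) (phi : formula) : Prop :=
  forall v : pvar -> set (world F), valuation v -> sem v phi = [set: world F].

Definition quantifiable_frame (F : frame) : Prop :=
  general_frame F /\
  forall (phi : formula) (v : pvar -> set (world F)),
    valuation v -> adm F (sem v phi).

(* Modal and quantified formulas count as propositional atoms here. *)
Definition tautology (phi : formula) : Prop :=
  forall e : formula -> bool,
    (forall psi, e (Neg psi) = ~~ e psi) ->
    (forall psi chi, e (Or psi chi) = e psi || e chi) ->
    e phi.

Record normal_pqml (L : set formula) : Prop := NormalPQML {
  npqml_taut : forall phi, tautology phi -> L phi;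
  npqml_K : forall p q : pvar, p != q ->
    L (Imp (Box (Imp (Var p) (Var q))) (Imp (Box (Var p)) (Box (Var q))));
  npqml_dual : forall p : pvar, L (Iff (Dia (Var p)) (Neg (Box (Neg (Var p)))));
  npqml_EI : forall (p : pvar) (phi psi : formula),
    L (Imp (subst1 p psi phi) (Ex p phi));
  npqml_nec : forall phi, L phi -> L (Box phi);
  npqml_MP : forall phi psi, L phi -> L (Imp phi psi) -> L psi;
  npqml_EE : forall (p : pvar) (phi psi : formula),
    L (Imp phi psi) -> p \notin Fv psi -> L (Imp (Ex p phi) psi)
}.

Definition instances (A : set formula) : set formula :=
  [set phi | exists sigma, exists2 alpha, A alpha & phi = subst sigma alpha].

Definition KPi (A : set formula) : set formula :=
  \bigcap_(L in [set L | normal_pqml L /\ instances A `<=` L]) L.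

(* The letters p, q in axioms stand for arbitrary distinct variables, so each
   axiom is the set of its alphabetic variants. *)
Definition ax5 : set formula :=
  [set phi | exists p : pvar, phi = Imp (Dia (Var p)) (Box (Dia (Var p)))].

Definition axBc : set formula :=
  [set phi | exists (p : pvar) (psi : formula),
    phi = Imp (Dia (Ex p psi)) (Ex p (Dia psi))].

Definition Q (n : nat) (phi : formula) : formula :=
  let p := first_notin (Fv phi) in
  And (dia_le n phi)
      (All p (Or (box_le n (Imp phi (Var p)))
                 (box_le n (Imp phi (Neg (Var p)))))).

Definition At (n : nat) (p q : pvar) : formula :=
  All q (Imp (dia_le n (Var q))
             (Ex p (And (Q n (Var p)) (box_le n (Imp (Var p) (Var q)))))).

Definition axAt (n : nat) : set formula :=
  [set phi | exists p q : pvar, p != q /\ phi = At n p q].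

(* [None] is the extra point w; [Some n] is the natural number n. *)
Definition cofinite_frame : frame := {|
  world := option nat;
  acc := fun x y =>
    (exists m n : nat, x = Some m /\ y = Some n) \/
    (x = None /\ exists n : nat, y = Some (2 * n));
  adm := [set X | finite_set X \/ finite_set (~` X)]
|}.

(* Main.v *)
Require Import Defs.
From mathcomp Require Import all_boot.
From mathcomp Require Import boolp classical_sets cardinality.

(** Truth at a natural number only depends on the traces of the values of the
    free variables on N, and there all numbers are R-related, so it is invariant
    under every involution of N. Swapping two numbers outside the finitely many
    exceptional points of these values shows that any definable set is constant
    off a finite set; hence the frame is quantifiable. Validity on a quantifiable
    frame is closed under all rules and under substitution instances; Bc is valid
    on every general frame, 5 because R is Euclidean, and At^2 because singletons
    are admissible. At w, an admissible p with [Box p] contains all even numbers,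
    hence is cofinite and contains an odd number m; then [q = p \ {m}] refutes
    the last formula, since [Box q] holds at w and m is two steps away from w. *)

Set Implicit Arguments.
Unset Strict Implicit.
Unset Printing Implicit Defensive.

Local Open Scope classical_set_scope.

(** * Updates and fresh variables *)

Lemma updateE T (f : nat -> T) p x : update f p x p = x.
Proof. by rewrite /update eqxx. Qed.

Lemma update_neq T (f : nat -> T) p r x : r != p -> update f p x r = f r.
Proof. by rewrite /update => /negbTE ->. Qed.

Lemma first_notinP (s : seq nat) : first_notin s \notin s.
Proof. by rewrite /first_notin; case: ex_minnP. Qed.

Lemma Fv_sub_vars phi : {subset Fv phi <= vars phi}.
Proof.
elim: phi => /= [p|phi IH|phi IH psi IH'|phi IH|p psi IH] r //.
- exact: IH.
- by rewrite !mem_cat => /orP[/IH|/IH'] ->; rewrite ?orbT.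
- exact: IH.
- by rewrite mem_filter inE => /andP[_ /IH ->]; rewrite orbT.
Qed.

Lemma notin_flatten_map (T : eqType) (f : T -> seq nat) (s : seq T) q r :
  q \notin flatten (map f s) -> r \in s -> q \notin f r.
Proof. by move=> qs rs; apply: contra qs => qr; apply/flatten_mapP; exists r. Qed.

(** * Semantics of formulas and substitutions on an arbitrary frame *)

Section Semantics.
Variable F : frame.
Implicit Types (v : nat -> set (world F)) (X Y : set (world F)) (w : world F).

Lemma sem_Imp v a b w : sem v (Imp a b) w <-> (sem v a w -> sem v b w).
Proof.
rewrite /=; split=> [[//|//]|ab].
by case: (pselect (sem v a w)) => [/ab|]; [right|left].
Qed.

Lemma sem_And v a b w : sem v (And a b) w <-> sem v a w /\ sem v b w.
Proof.
rewrite /=; split=> [ab|[wa wb] [/(_ wa)|/(_ wb)]//].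
by split; apply: contrapT => nab; apply: ab; [left|right].
Qed.

Lemma sem_Box v a w : sem v (Box a) w <-> forall u, acc w u -> sem v a u.
Proof.
split=> [H u wu|H [u nau wu]]; last exact/nau/H.
by apply: contrapT => nau; apply: H; exists u.
Qed.

Lemma sem_Ex v p a w :
  sem v (Ex p a) w <-> exists2 X, adm F X & sem (update v p X) a w.
Proof. by []. Qed.

Lemma sem_All v p a w :
  sem v (All p a) w <-> forall X, adm F X -> sem (update v p X) a w.
Proof.
split=> [H X FX|H [X FX]]; last by apply; apply: H.
by apply: contrapT => na; apply: H; exists X.
Qed.

Lemma eq_sem_Fv v v' phi :
  {in Fv phi, v =1 v'} -> sem v phi = sem v' phi.
Proof.
elim: phi v v' => /= [p|phi IH|phi IHphi psi IHpsi|phi IH|p phi IH] v v' vv'.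
- by rewrite vv' ?mem_head.
- by rewrite (IH v v').
- rewrite (IHphi v v') ?(IHpsi v v') // => r rF;
    by apply: vv'; rewrite mem_cat rF ?orbT.
- by rewrite (IH v v').
- apply: eq_bigcupr => X _; apply: IH => r rphi; rewrite /update.
  by have [//|rp] := eqVneq r p; apply: vv'; rewrite mem_filter rp.
Qed.

(** The renamed bound variable [q] is free in no [sigma r] with [r] free in [Ex p phi], so giving
    [q] the value [X] leaves the values of these [sigma r] unchanged. *)
Lemma sem_subst v sigma phi :
  sem v (subst sigma phi) = sem (fun r => sem v (sigma r)) phi.
Proof.
elim: phi v sigma => /= [//|phi IH|phi IHphi psi IHpsi|phi IH|p phi IH] v sigma.
- by rewrite IH.
- by rewrite IHphi IHpsi.
- by rewrite IH.
set q := (if _ then _ else _); set fv := [seq r <- Fv phi | r != p].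
have qF r : r \in fv -> q \notin Fv (sigma r).
  rewrite /q; case: ifPn => [pN rfv|_ rfv].
    exact: (notin_flatten_map (f := fun r => Fv (sigma r)) pN).
  have := first_notinP
    (p :: vars phi ++ flatten [seq vars (sigma r) | r <- fv]).
  rewrite inE mem_cat !negb_or => /and3P[_ _].
  move=> /(notin_flatten_map (f := fun r => vars (sigma r)))/(_ rfv).
  exact/contra/Fv_sub_vars.
apply: eq_bigcupr => X _; rewrite IH; apply: eq_sem_Fv => r rphi.
have [->|rp] := eqVneq r p; first by rewrite !updateE /= updateE.
rewrite !update_neq //; apply: eq_sem_Fv => s sr; rewrite update_neq //.
apply: contraNneq (qF r _) => [<-//|]; by rewrite mem_filter rp.
Qed.

Lemma valuation_update v p X :
  valuation v -> adm F X -> valuation (update v p X).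
Proof. by move=> vP FX r; rewrite /update; case: ifP. Qed.

Lemma validatesP phi :
  (forall v w, valuation v -> sem v phi w) -> validates F phi.
Proof. by move=> H v vP; apply/seteqP; split=> // w _; apply: H. Qed.

Lemma validatesE phi v w : validates F phi -> valuation v -> sem v phi w.
Proof. by move=> H vP; rewrite H. Qed.

(** Membership of a fixed world [w] respects negation and disjunction, so it is one of the
    evaluations [e] ranged over in [tautology]. *)
Lemma validates_tautology phi : tautology phi -> validates F phi.
Proof.
move=> phiP; apply: validatesP => v w _; apply/asboolP.
apply: (phiP (fun psi => `[< sem v psi w >])) => [psi|psi chi].
  exact: asbool_neg.
exact: asbool_or.
Qed.

Lemma validates_Bc p psi : validates F (Imp (Dia (Ex p psi)) (Ex p (Dia psi))).
Proof.
apply: validatesP => v w _; apply/sem_Imp => -[u [X FX uX] wu].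
by exists X => //; exists u.
Qed.

Lemma validates_5 p : (forall x y z : world F, acc x y -> acc x z -> acc y z) ->
  validates F (Imp (Dia (Var p)) (Box (Dia (Var p)))).
Proof.
move=> eucl; apply: validatesP => v w _; apply/sem_Imp => -[u pu wu].
by apply/sem_Box => z wz; exists u => //; apply: eucl wz wu.
Qed.

(** * Reachability in boundedly many steps, and the atomicity axiom *)

Fixpoint steps k (x y : world F) : Prop :=
  if k is j.+1 then exists2 z, acc x z & steps j z y else x = y.

Fixpoint reach k (x y : world F) : Prop :=
  if k is j.+1 then reach j x y \/ steps j.+1 x y else x = y.

Lemma sem_dia_iter v k a x :
  sem v (dia_iter k a) x <-> exists2 y, steps k x y & sem v a y.
Proof.
elim: k x => [|k IH] x; first by split=> [xa|[_ <-]//]; exists x.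
split=> [[z /IH[y zy ya] xz]|[y [z xz zy] ya]]; first by exists y => //; exists z.
by exists z => //; apply/IH; exists y.
Qed.

Lemma sem_box_iter v k a x :
  sem v (box_iter k a) x <-> forall y, steps k x y -> sem v a y.
Proof.
elim: k x => [|k IH] x; first by split=> [xa _ <-//|]; apply.
split=> [/sem_Box H y [z xz]|H]; first exact: (IH z).1 (H z xz) y.
by apply/sem_Box => z xz; apply/IH => y zy; apply: H; exists z.
Qed.

Lemma sem_dia_le v k a x :
  sem v (dia_le k a) x <-> exists2 y, reach k x y & sem v a y.
Proof.
elim: k => [|k IH]; first by split=> [xa|[_ <-]//]; exists x.
split=> [[/IH[y xy ya]|/(sem_dia_iter v k.+1)[y xy ya]]|[y [xy|xy] ya]].
- by exists y => //; left.
- by exists y => //; right.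
- by left; apply/IH; exists y.
- by right; apply/(sem_dia_iter v k.+1); exists y.
Qed.

Lemma sem_box_le v k a x :
  sem v (box_le k a) x <-> forall y, reach k x y -> sem v a y.
Proof.
elim: k => [|k IH]; first by split=> [xa _ <-//|]; apply.
split=> [/sem_And[/IH H /(sem_box_iter v k.+1) H'] y [/H|/H']//|H].
apply/sem_And; split; first by apply/IH => y xy; apply: H; left.
by apply/(sem_box_iter v k.+1) => y xy; apply: H; right.
Qed.

(** A singleton inside [X] witnesses the inner quantifier: an admissible [Y] contains its point or
    misses it, which selects a disjunct of [Q]. *)
Lemma validates_At n p q : p != q -> (forall x, adm F [set x]) ->
  validates F (At n p q).
Proof.
move=> pq F1; apply: validatesP => v x vP; apply/sem_All => X FX; apply/sem_Imp.
move=> /sem_dia_le[y xy yX]; exists [set y] => //.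
have {yX}Xy : X y by move: yX; rewrite /= updateE.
apply/sem_And; split; last first.
  apply/sem_box_le => z _; apply/sem_Imp; rewrite /= updateE => ->.
  by rewrite update_neq 1?eq_sym // updateE.
rewrite /Q; set r := first_notin _; apply/sem_And; split.
  by apply/sem_dia_le; exists y => //=; rewrite updateE.
have pr : p != r.
  by have := first_notinP (Fv (Var p)); rewrite inE eq_sym.
apply/sem_All => Y FY; have [Yy|Yy] := pselect (Y y); [left|right];
  apply/sem_box_le => z _; apply/sem_Imp;
  by rewrite /= update_neq // !updateE => ->.
Qed.

(** * Soundness on quantifiable frames *)

Hypothesis Fquant : quantifiable_frame F.

(** Quantifiability makes [fun r => sem v (sigma r)] a valuation. *)
Lemma validates_subst sigma phi :
  validates F phi -> validates F (subst sigma phi).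
Proof.
move=> phiP v vP; rewrite sem_subst; apply: phiP => r; exact: Fquant.2.
Qed.

Lemma normal_validates : normal_pqml (validates F).
Proof.
split=> [|p q _|p|p phi psi|phi phiP|phi psi phiP ipP|p phi psi ipP pN].
- exact: validates_tautology.
- apply: validatesP => v w _; apply/sem_Imp => /sem_Box pq; apply/sem_Imp.
  move=> /sem_Box wp; apply/sem_Box => u wu.
  by move: (pq u wu) => /sem_Imp; apply; apply: wp.
- apply: validatesP => v w _; apply/sem_And; split; apply/sem_Imp.
    by move=> [u pu wu]; apply; exists u => /=.
  by move=> /contrapT[u /contrapT pu wu]; exists u.
- apply: validatesP => v w vP; apply/sem_Imp; rewrite /subst1 sem_subst => wphi.
  (* The value of [psi] is admissible because the frame is quantifiable. *)
  exists (sem v psi); first exact: Fquant.2.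
  by congr (sem _ phi w): wphi; apply/funext => r; rewrite /update; case: ifP.
- by apply: validatesP => v w vP; apply/sem_Box => u _; apply: validatesE.
- apply: validatesP => v w vP.
  by have /sem_Imp := validatesE w ipP vP; apply; apply: validatesE.
- apply: validatesP => v w vP; apply/sem_Imp => -[X FX].
  have /sem_Imp H := validatesE w ipP (valuation_update p vP FX).
  move=> /H; rewrite (@eq_sem_Fv _ v) // => r rF.
  by rewrite update_neq //; apply: contraNneq pN => <-.
Qed.

Lemma KPi_sound A phi :
  (forall alpha, A alpha -> validates F alpha) -> KPi A phi -> validates F phi.
Proof.
move=> AP; apply; split; first exact: normal_validates.
by move=> _ [sigma [alpha /AP alphaP ->]]; apply: validates_subst.
Qed.

End Semantics.

(** * The frame of finite and cofinite sets *)

Notation cofinF := cofinite_frame.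

Lemma adm_setC (X : set (option nat)) : adm cofinF X -> adm cofinF (~` X).
Proof. by rewrite /= setCK => -[]; [right|left]. Qed.

Lemma adm_set1 x : adm cofinF [set x].
Proof. by left. Qed.

Lemma adm_setD1 (X : set (option nat)) x : adm cofinF X -> adm cofinF (X `\ x).
Proof.
case=> Xfin; [left|right]; first exact: finite_setD.
by rewrite setDE setCI setCK finite_setU; split.
Qed.

Lemma acc_Some n (y : world cofinF) :
  @acc cofinF (Some n) y <-> exists m, y = Some m.
Proof.
split=> [[[? [m [_ ->]]]|[]//]|[m ->]]; first by exists m.
by left; exists n, m.
Qed.

Lemma acc_None (y : world cofinF) :
  @acc cofinF None y <-> exists m, y = Some (2 * m)%N.
Proof. by split=> [[[? [? []//]]|[]//]|yE]; right. Qed.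

(** Every successor is a number, and all numbers see each other. *)
Lemma acc_euclidean (x y z : world cofinF) : acc x y -> acc x z -> acc y z.
Proof.
have accS (x' y' : world cofinF) : acc x' y' -> exists m, y' = Some m.
  by case: x' => [n /acc_Some//|/acc_None[m ->]]; eexists.
by move=> /accS[m ->] /accS[n ->]; apply/acc_Some; exists n.
Qed.

(** * Invariance under involutions of the numbers *)

Section Swap.
Variable f : nat -> nat.
Hypothesis fK : involutive f.

(** [omap f] is injective, so preimages of finite sets are finite, and preimages commute with
    complements. *)
Lemma adm_preimage_omap (X : set (option nat)) :
  adm cofinF X -> adm cofinF (omap f @^-1` X).
Proof.
have inj (Y : set (option nat)) : {in omap f @^-1` Y &, injective (omap f)}.
  by move=> [a|] [b|] _ _ //= [/(inv_inj fK) ->].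
by case=> /(finite_preimage (inj _)); [left|right].
Qed.

(** Successors of numbers are numbers, so values at the extra point never matter. A witness of a
    quantifier is carried over by preimage under [omap f], which is its own inverse. *)
Lemma sem_omap phi (v v' : nat -> set (world cofinF)) n :
  (forall p k, p \in Fv phi -> v p (Some k) <-> v' p (Some (f k))) ->
  sem v phi (Some n) <-> sem v' phi (Some (f n)).
Proof.
elim: phi v v' n => /= [p|phi IH|phi IHphi psi IHpsi|phi IH|p phi IH] v v' n vv'.
- by apply: vv'; rewrite mem_head.
- by split=> H; apply: contra_not H; rewrite (IH v v').
- rewrite (IHphi v v') ?(IHpsi v v') // => r k rF;
    by apply: vv'; rewrite mem_cat rF ?orbT.
- split=> -[u us /acc_Some[m um]]; subst u.
    by exists (Some (f m)); [apply/(IH v v')|apply/acc_Some; exists (f m)].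
  exists (Some (f m)); [apply/(IH v v') => //|apply/acc_Some; exists (f m) => //].
  by rewrite fK.
- have vvX (X X' : set (option nat)) :
      (forall k, X (Some k) <-> X' (Some (f k))) ->
      sem (F := cofinF) (update v p X) phi (Some n) <->
      sem (F := cofinF) (update v' p X') phi (Some (f n)).
    move=> XX'; apply: IH => r k rphi; rewrite /update.
    by case: eqVneq => [//|rp]; apply: vv'; rewrite mem_filter rp.
  split=> -[X FX Xphi]; (exists (omap f @^-1` X); first exact: adm_preimage_omap).
    by apply: (vvX X _ _).1 Xphi => k /=; rewrite fK.
  exact: (vvX _ X _).2 Xphi.
Qed.

End Swap.

(** * Admissibility of definable sets *)

Definition swap (a b k : nat) := if k == a then b else if k == b then a else k.

Lemma swapK a b : involutive (swap a b).
Proof.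
move=> k; rewrite /swap; have [->|ka] := eqVneq k a.
  by case: eqVneq => [->|]//; rewrite eqxx.
have [->|kb] := eqVneq k b; first by rewrite eqxx.
by rewrite (negbTE ka) (negbTE kb).
Qed.

(** A finite value is constant off itself, a cofinite one off its complement; finitely many such
    exceptions have a finite union. *)
Lemma exceptional_set (v : nat -> set (world cofinF)) (s : seq nat) :
  valuation v ->
  exists2 S : set (option nat), finite_set S &
    forall p, p \in s -> forall x y, ~ S x -> ~ S y -> v p x -> v p y.
Proof.
move=> vP; elim: s => [|p s [S Sfin SP]]; first by exists set0.
have [T Tfin TP] : exists2 T : set (option nat), finite_set T &
    forall x y, ~ T x -> ~ T y -> v p x -> v p y.
  have [pfin|pfin] := vP p; [by exists (v p)|exists (~` v p) => //].
  by move=> x y _ /contrapT.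
exists (T `|` S); first by rewrite finite_setU.
move=> r; rewrite inE => /orP[/eqP ->|rs] x y;
  rewrite !not_orE => -[Tx Sx] [Ty Sy]; [exact: TP|exact: SP].
Qed.

Lemma adm_sem phi (v : nat -> set (world cofinF)) :
  valuation v -> adm cofinF (sem v phi).
Proof.
move=> vP; have [S Sfin SP] := exceptional_set (Fv phi) vP.
have semS a b : ~ S (Some a) -> ~ S (Some b) ->
    sem v phi (Some a) -> sem v phi (Some b).
  (* The swap carries [a] to [b] and preserves the value of each free variable, since that value
     does not separate points off [S]. *)
  move=> Sa Sb; have -> : b = swap a b a by rewrite /swap eqxx.
  apply: (sem_omap (swapK a b) a _).1 => p k pF; rewrite /swap.
  have [->|ka] := eqVneq k a; first by split; apply: SP.
  by have [->|//] := eqVneq k b; split; apply: SP.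
(* The invariance says nothing about the extra point, so it joins the exceptions. *)
have S0fin : finite_set (None |` S) by rewrite finite_setU.
(* If one number off [S] satisfies [phi], all do and the value is cofinite; otherwise it is
   finite. *)
have [[a [Sa aphi]]|noa] :=
  pselect (exists a, ~ S (Some a) /\ sem v phi (Some a)); [right|left].
  apply: sub_finite_set S0fin => -[b|] bN; [right|by left].
  by apply: contrapT => Sb; apply: bN; apply: semS aphi.
apply: sub_finite_set S0fin => -[b|] bP; [right|by left].
by apply: contrapT => Sb; apply: noa; exists b.
Qed.

Lemma quantifiable_cofinite_frame : quantifiable_frame cofinF.
Proof.
split; last exact: adm_sem.
(* Unions and [mdia] of admissible sets are values of formulas, so closure follows from [adm_sem],
   whose proof does not presuppose a general frame. *)
have semX (X Y : set (option nat)) phi : adm cofinF X -> adm cofinF Y ->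
    adm cofinF (sem (F := cofinF) (fun p => if p is 0 then X else Y) phi).
  by move=> XP YP; apply: adm_sem => -[].
split=> [| |X XP|X Y XP YP|X XP].
- by exists None.
- by exists set0; left.
- exact: adm_setC.
- exact: (semX X Y (Or (Var 0) (Var 1))).
- exact: (semX X X (Dia (Var 0))).
Qed.

(** Evens and odds are both infinite: a finite set cannot contain all the former, nor a finite
    complement all the latter. *)
Lemma adm_contains_odd (X : set (option nat)) : adm cofinF X ->
  (forall n, X (Some (2 * n))) -> exists n, X (Some (2 * n).+1).
Proof.
move=> XP Xeven; apply: contrapT => Xodd.
have infinite_range (g : nat -> option nat) : injective g ->
    ~ finite_set (range g).
  move=> ginj; rewrite (eq_finite_set (inj_card_eq _)); last by move=> a b _ _ /ginj.
  exact: infinite_nat.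
case: XP => Xfin.
  apply: (infinite_range (fun n => Some (2 * n))) => [a b [] /eqP|].
    by rewrite eqn_mul2l => /eqP.
  by apply: sub_finite_set Xfin => _ [n _ <-].
apply: (infinite_range (fun n => Some (2 * n).+1)) => [a b [] /eqP|].
  by rewrite eqn_mul2l => /eqP.
by apply: sub_finite_set Xfin => _ [n _ <-] Xn; apply: Xodd; exists n.
Qed.

Theorem proposition5p11 :
  [/\ quantifiable_frame cofinite_frame,
      (forall phi : formula,
         KPi (ax5 `|` axBc `|` axAt 2) phi -> validates cofinite_frame phi)
    & (forall p q : nat, p != q ->
         ~ validates cofinite_frame
             (Ex p (And (Box (Var p))
                        (All q (Imp (Box (Var q))
                                    (box_iter 2 (Imp (Var p) (Var q))))))))].
Proof.
have Fquant := quantifiable_cofinite_frame; split=> // [phi|p q pq valid].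
  apply: KPi_sound => // _ [[[p ->]|[p [psi ->]]]|[p [q [pq ->]]]].
  - exact/validates_5/acc_euclidean.
  - exact: validates_Bc.
  - by apply: validates_At => // x; apply: adm_set1.
(* The formula is closed, so any valuation serves. *)
have v0 : valuation (F := cofinF) (fun=> set0) by left.
have /sem_Ex[X XP /sem_And[/sem_Box Xbox /sem_All Xall]] :=
  validatesE (None : world cofinF) valid v0.
have [n Xn] : exists n, X (Some (2 * n).+1).
  apply: adm_contains_odd => // n; have := Xbox (Some (2 * n)).
  by rewrite /= updateE; apply; apply/acc_None; exists n.
have /sem_Imp := Xall _ (adm_setD1 (Some (2 * n).+1) XP).
(* The extra point sees even numbers only, so removing an odd one keeps the box true there. *)
have qbox : sem (update (update (fun=> set0) p X) q (X `\ Some (2 * n).+1))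
    (Box (Var q)) (None : world cofinF).
  apply/sem_Box => u wu; rewrite /= updateE; split.
    by have := Xbox u wu; rewrite /= updateE.
  move/acc_None: wu => [m ->] [] /(congr1 odd).
  by rewrite /= !oddM.
move=> /(_ qbox)/sem_box_iter/(_ (Some (2 * n).+1)) H.
have /sem_Imp : sem (update (update (fun=> set0) p X) q (X `\ Some (2 * n).+1))
    (Imp (Var p) (Var q)) (Some (2 * n).+1 : world cofinF).
  (* The two-step path goes through 0, written as an even number to fit [acc_None]. *)
  apply: H; exists (Some (2 * 0)); first by apply/acc_None; exists 0.
  by exists (Some (2 * n).+1) => //; apply/acc_Some; eexists.
by rewrite /= update_neq // !updateE => /(_ Xn)[_]; apply.
Qed.
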